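(* Let $p$ be a prime. Any group in one of the following families is an S--group: (1) nonabelian finite $p$-groups of maximal nilpotency class; (2) nonabelian finite $2$-groups of coclass two; (3) nonabelian finite metacyclic $p$-groups.
   Context: A finite $p$-group of order $p^n$ and nilpotency class $c$ has coclass $n-c$; it has maximal nilpotency class if $c = n-1$ (coclass one). A group is metacyclic if it has a cyclic normal subgroup with cyclic quotient. For a finite $p$-group $G$, $\Phi(G)$ is the Frattini subgroup and the Frattini quotient $Q=G/\Phi(G)$ acts by conjugation on the center $A = Z(\Phi(G))$. For a finite group $Q$ and a $\mathbb{Z}Q$-module $A$, $\hat{H}^n(Q;A)$ denotes Tate cohomology; in particular $\hat{H}^0(Q;A)$ is $A^Q$ modulo the image of the trace map $a \mapsto \sum_{q\in Q} qa$. A finite nonabelian $p$-group $G$ is called an S--group if $\hat{H}^0(G/\Phi(G); Z(\Phi(G))) \neq 0$. *)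

(* Defs.v *)
From HB Require Import structures.
From mathcomp Require Import all_boot all_fingroup all_solvable.

Set Implicit Arguments.
Unset Strict Implicit.
Unset Printing Implicit Defensive.

Import GroupScope.

Section Tate.

Variables (qT aT : finGroupType) (D : {group qT}) (R : {group aT}).
Variable to : groupAction D R.

(* The trace map of the Q-module A. Modules are written multiplicatively, and
   the order of the factors is irrelevant because A is abelian in all uses. *)
Definition trace_map (Q : {set qT}) (a : aT) : aT := \prod_(q in Q) to a q.

Definition trace_image (Q : {set qT}) (A : {set aT}) : {set aT} :=
  [set trace_map Q a | a in A].

(* The Tate group H^0(Q; A) = A^Q / trace(A). The quotient is formed by the
   subgroup generated by trace(A), which is trace(A) itself when A is an
   abelian Q-module, and trace(A) normalises itself inside A^Q. *)
Definition tateH0 (Q : {set qT}) (A : {set aT}) :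
    {set coset_of (trace_image Q A)} :=
  'C_(A | to)(Q) / trace_image Q A.

End Tate.

Section SGroup.

Variable gT : finGroupType.
Implicit Type G : {group gT}.

(* 'J %% 'Phi(G) is conjugation viewed as an action of cosets of 'Phi(G) on
   the centraliser of 'Phi(G), which contains 'Z('Phi(G)). *)
Definition S_group G : Prop :=
  [/\ p_group G, ~~ abelian G &
      tateH0 ('J %% 'Phi(G))%gact (G / 'Phi(G)) 'Z('Phi(G)) <> 1].

(* The next two definitions are meant for p-groups G, where
   #|G| = p ^ logn p #|G|. The truncated subtraction is then exact, since the
   class of a group of order p ^ n is at most n. *)
Definition coclass (p : nat) G : nat := logn p #|G| - nil_class G.

Definition maximal_class (p : nat) G : Prop :=
  (nil_class G).+1 = logn p #|G|.

End SGroup.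

(* Main.v *)
Require Import Defs.
From mathcomp Require Import all_boot all_fingroup all_solvable.

Set Implicit Arguments.
Unset Strict Implicit.
Unset Printing Implicit Defensive.

Import GroupScope.

(** Write Phi for the Frattini subgroup of G, A for the centre of Phi and
    W for the intersection of A with the second centre of G.  The vanishing of
    the Tate group means that the trace map of G / Phi sends A onto its fixed
    points, which form A :&: 'Z(G) ([trace_onto]); each family is treated by
    refuting this.

    The trace is computed one generator at a time: if y normalises H, has
    n-th power in H and extends H to K with index n, then the trace over K is
    the norm a * a ^ y * ... * a ^ (y ^ (n-1)) of the trace over H
    ([trace_map_step]).

    The main criterion ([layer_not_onto]) is a count.  If a maximal subgroup M
    has no fixed point in A outside 'Z(G), then the trace over G is the p-th
    power of the trace over M, so it only produces p-th powers of elements of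
    A :&: 'Z(G), and not all of that nontrivial p-group.  A fixed point of M
    outside the centre would give one in W, and every element of G that acts
    nontrivially on what remains of W divides the fixed points by at least p;
    so such an M exists as soon as #|W : W :&: 'Z(G)| < #|G : Phi|.  In a
    nonabelian group of order p ^ (c + k) and class c the order of W is at most
    p ^ (k + 1) ([layer_card_leq]), so for k = 1 the criterion always applies.

    When #|G : Phi| = p ^ 2, surjectivity of the trace has two further
    consequences, both obtained by counting kernels and images as for Herbrand
    quotients and then cancelling commutators by nilpotency: for x in G outside
    Phi the norm of x maps A onto 'C_A[x] ([onto_cyclic_norm]), and the
    coinvariants A / [~: A, G] are no larger than the invariants
    ([onto_coinvariants]).

    If G is metacyclic, let a generate the cyclic normal subgroup.  The norm
    of a is the p-th power map up to elements of order p, and it maps A onto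
    D = 'C_A[a], which has index at most p in A.  This forces A to be cyclic or
    of order at most p ^ 2, and the criterion applies again
    ([metacyclic_not_onto]).

    If G is a 2-group of coclass two with #|G : G^`(1)| <= 4, then G has a
    cyclic maximal subgroup ([der1_index4_metacyclic]), so it is metacyclic.
    Otherwise #|G : G^`(1)| = 8, and the criterion leaves only the case where
    #|W| = 8, #|W :&: 'Z(G)| = 2 and #|G : Phi| = 4.  The order of G^`(1)
    is then too small for it to contain W, and the coinvariants of A have order
    at most 2, so A = W [~: A, G], hence A = W; but [~: W, G] is central, which
    leaves at least 4 coinvariants ([coclass2_not_onto]). *)

(** * Norms of a single element acting on an abelian group *)

(** A form of Nakayama's lemma: modulo B the hypothesis says that D / B is
    contained in [~: D / B, G / B], which in a nilpotent group forces D / B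
    to be trivial. *)
Lemma nilpotent_supplement_sub (gT : finGroupType) (G B D : {group gT}) :
  nilpotent G -> B <| G -> D <| G -> D \subset B * [~: D, G] -> D \subset B.
Proof.
move=> nilG /andP[_ nBG] /andP[sDG nDG] sDB.
have nBD := subset_trans sDG nBG.
rewrite -quotient_sub1 // subG1.
have /forallP/(_ (D / B)%G)/implyP := quotient_nil B nilG; apply.
rewrite subsetI quotientS //= -quotientR //.
by rewrite -(quotientMidl B [~: D, G]) quotientS.
Qed.

Section NormMap.

Variable gT : finGroupType.
Implicit Types (A D : {group gT}) (n : nat) (x y a : gT).

(** The trace of the cyclic group generated by x, on a module on which x ^+ n
    acts trivially. *)
Definition cyclic_norm n x a := \prod_(i < n) a ^ (x ^+ i).

Lemma cyclic_normS n x a :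
  cyclic_norm n.+1 x a = cyclic_norm n x a * a ^ (x ^+ n).
Proof. by rewrite /cyclic_norm big_ord_recr. Qed.

Lemma cyclic_norm_recl n x a :
  cyclic_norm n.+1 x a = a * cyclic_norm n x a ^ x.
Proof.
elim: n => [|n IHn].
  by rewrite cyclic_normS /cyclic_norm big_ord0 conj1g mul1g mulg1 conjg1.
rewrite cyclic_normS [in LHS]IHn cyclic_normS conjMg -conjgM -expgSr.
by rewrite -[LHS]mulgA.
Qed.

Lemma cyclic_norm_cent1 n x a :
  a \in 'C[x] -> cyclic_norm n x a = a ^+ n.
Proof.
move=> cax; elim: n => [|n IHn]; first by rewrite /cyclic_norm big_ord0.
rewrite cyclic_normS IHn expgSr; congr (_ * _).
by apply/conjg_fixP/commgP/commuteX/cent1P.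
Qed.

Section OneModule.

Variables (A : {group gT}) (n : nat) (x : gT).
Hypotheses (abA : abelian A) (nAx : x \in 'N(A)).

Lemma conjX_mem a i : a \in A -> a ^ (x ^+ i) \in A.
Proof. by move=> Aa; rewrite memJ_norm ?groupX. Qed.

Lemma cyclic_norm_mem a : a \in A -> cyclic_norm n x a \in A.
Proof. by move=> Aa; apply: group_prod => i _; apply: conjX_mem. Qed.

Lemma cyclic_normM : {in A &, {morph cyclic_norm n x : a b / a * b}}.
Proof.
move=> a b Aa Ab /=.
elim: n => [|k IHk]; first by rewrite /cyclic_norm !big_ord0 mulg1.
have Nk c : c \in A -> cyclic_norm k x c \in A.
  by move=> Ac; apply: group_prod => i _; apply: conjX_mem.
rewrite !cyclic_normS IHk conjMg.
have := centsP abA _ (Nk b Ab) _ (conjX_mem k Aa).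
move: (cyclic_norm k x b) (a ^ _) => u v cuv.
by rewrite -[RHS]mulgA [v * (u * _)]mulgA -cuv -[LHS]mulgA -[u * v * _]mulgA.
Qed.
Canonical cyclic_norm_morphism := Morphism cyclic_normM.

Hypothesis cAxn : x ^+ n \in 'C(A).

(** Conjugation by x permutes the factors cyclically. *)
Lemma cyclic_norm_fixed a : a \in A -> cyclic_norm n x a \in 'C_A[x].
Proof.
move=> Aa; rewrite inE cyclic_norm_mem //; apply/cent1P/commgP/conjg_fixP.
apply: (mulgI a); rewrite -cyclic_norm_recl cyclic_normS.
rewrite (centsP abA) ?conjX_mem ?cyclic_norm_mem //; congr (_ * _).
by apply/conjg_fixP/commgP/commute_sym; apply: (centP cAxn).
Qed.

Lemma commg_mem a : a \in A -> [~ a, x] \in A.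
Proof. by move=> Aa; rewrite commgEl groupM ?groupV ?memJ_norm. Qed.

Lemma cyclic_norm_conj y a :
  y \in 'N(A) -> [~ x, y] \in 'C(A) -> a \in A ->
  cyclic_norm n x (a ^ y) = cyclic_norm n x a ^ y.
Proof.
move=> nAy cAxy Aa.
have conjC b : b \in A -> b ^ (x * y) = b ^ (y * x).
  move=> Ab; rewrite (commgC x y) conjgM; apply/conjg_fixP/commgP/commute_sym.
  by apply: (centP cAxy); rewrite memJ_norm ?groupM.
rewrite /cyclic_norm.
have -> : (\prod_(i < n) a ^ x ^+ i) ^ y = \prod_(i < n) (a ^ x ^+ i) ^ y.
  by apply: (big_morph (conjg^~ y)) => [u v|]; rewrite ?conjMg ?conj1g.
apply: eq_bigr => [[i _] _] /=; elim: i => [|i IHi]; first by rewrite !conjg1.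
have := conjC _ (conjX_mem i Aa).
by rewrite expgSr !conjgM IHi => ->.
Qed.

Lemma cyclic_norm_commg y a :
  y \in 'N(A) -> [~ x, y] \in 'C(A) -> a \in A ->
  cyclic_norm n x [~ a, y] = [~ cyclic_norm n x a, y].
Proof.
move=> nAy cAxy Aa; rewrite !commgEl cyclic_normM ?groupV ?memJ_norm //.
by rewrite (morphV cyclic_norm_morphism) // cyclic_norm_conj.
Qed.

Lemma cyclic_norm_comm1 a : a \in A -> cyclic_norm n x [~ a, x] = 1.
Proof.
move=> Aa; rewrite cyclic_norm_commg // ?commgg ?group1 //.
apply/eqP/commgP/cent1P.
by case/setIP: (cyclic_norm_fixed Aa).
Qed.

Lemma commg_morphic : {in A &, {morph (fun a => [~ a, x]) : a b / a * b}}.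
Proof.
move=> a b Aa Ab /=; rewrite commMgJ; congr (_ * _).
by apply/conjg_fixP/commgP; apply: (centsP abA); rewrite ?commg_mem.
Qed.
Canonical commg_morphism := Morphism commg_morphic.

Lemma card_commg D :
  D \subset A -> (#|'C_D[x]| * #|commg_morphism @* D|)%N = #|D|.
Proof.
move=> sDA; rewrite card_morphim (setIidPr sDA).
have -> : 'C_D[x] = D :&: 'ker commg_morphism.
  apply/setP=> a; rewrite in_setI [RHS]in_setI.
  case Da: (a \in D) => //=; have Aa := subsetP sDA a Da.
  by rewrite (sameP (kerP commg_morphism Aa) eqP) /= (sameP cent1P commgP).
exact: LagrangeI.
Qed.

Lemma card_cyclic_norm D :
  D \subset A ->
  (#|'ker_D cyclic_norm_morphism| * #|cyclic_norm_morphism @* D|)%N = #|D|.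
Proof. by move=> sDA; rewrite card_morphim (setIidPr sDA) LagrangeI. Qed.

(** If the norm of x maps D onto its fixed points, its kernel has order
    #|D : 'C_D[x]|.  This is also the number of commutators [~ e, x] with e in
    D, and these lie in the kernel, so they exhaust it. *)
Lemma cyclic_norm_kernel D d :
    D \subset A -> x \in 'N(D) ->
    'C_D[x] \subset cyclic_norm_morphism @* D ->
  d \in D -> cyclic_norm n x d = 1 -> exists2 e, e \in D & d = [~ e, x].
Proof.
move=> sDA nDx onto Dd Nd1.
have sIK : commg_morphism @* D \subset 'ker_D cyclic_norm_morphism.
  apply/subsetP=> _ /morphimP[e Ae De ->] /=.
  have De1 : [~ e, x] \in D by rewrite commgEl groupM ?groupV ?memJ_norm.
  by rewrite !inE De1 (subsetP sDA) //= cyclic_norm_comm1.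
have /eqP eIK : commg_morphism @* D == 'ker_D cyclic_norm_morphism.
  rewrite eqEcard sIK -(leq_pmul2r (cardG_gt0 [group of 'C_D[x]])).
  rewrite [X in _ <= X]mulnC card_commg // -(card_cyclic_norm sDA) /=.
  by rewrite leq_mul2l subset_leq_card ?orbT.
have: d \in commg_morphism @* D.
  by rewrite eIK !inE Dd (subsetP sDA) //= Nd1 eqxx.
by case/morphimP=> e _ De ->; exists e.
Qed.

End OneModule.
End NormMap.

Arguments cyclic_norm_kernel [gT A n x] abA nAx cAxn [D d].

(** * The trace map along a chain of subgroups *)

Section TraceTower.

Import FiniteModule.

Variables (gT : finGroupType) (G N A : {group gT}).
Hypotheses (nsNG : N <| G) (nAG : G \subset 'N(A)).
Hypotheses (abA : abelian A) (cNA : A \subset 'C(N)).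
Implicit Types (H : {group gT}) (a y : gT).

Local Notation act := ('J %% N)%gact.

Lemma coset_actE a g : a \in A -> g \in G -> act a (coset N g) = a ^ g.
Proof.
move=> Aa Gg; rewrite /= modactE ?in_setT //.
  by rewrite (subsetP (normal_norm nsNG)).
by rewrite setTI afixJ (subsetP cNA).
Qed.

Lemma coset_act_mem H a q :
  H \subset G -> a \in A -> q \in H / N -> act a q \in A.
Proof.
move=> sHG Aa /morphimP[g _ Hg ->]; have Gg := subsetP sHG g Hg.
by rewrite coset_actE // memJ_norm ?(subsetP nAG).
Qed.

(** The product that defines the trace is taken in a group which need not be
    commutative.  Reading it as a sum in the Z-module attached to A makes
    reindexing available. *)
Lemma trace_map_sum H a : H \subset G -> a \in A ->
  trace_map act (H / N) a = fmval (\sum_(q in H / N) fmod abA (act a q))%R.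
Proof.
move=> sHG Aa; rewrite fmval_sum; apply: eq_bigr => q Hq.
by rewrite [fmval _]fmodK ?(coset_act_mem sHG).
Qed.

Lemma trace_map_mem H a :
  H \subset G -> a \in A -> trace_map act (H / N) a \in A.
Proof. by move=> sHG Aa; rewrite trace_map_sum // fmodP. Qed.

Lemma trace_mapM H : H \subset G ->
  {in A &, {morph trace_map act (H / N) : a b / a * b}}.
Proof.
move=> sHG a b Aa Ab; rewrite /= !trace_map_sum ?groupM // -fmvalA.
rewrite -big_split /=; congr fmval; apply: eq_bigr => _ /morphimP[g _ Hg ->].
have Gg := subsetP sHG g Hg.
by rewrite !coset_actE ?groupM // conjMg fmodM // memJ_norm ?(subsetP nAG).
Qed.

Lemma trace_map_base a : a \in A -> trace_map act (N / N) a = a.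
Proof.
move=> Aa; rewrite /trace_map trivg_quotient big_set1 -(morph1 (coset N)).
by rewrite coset_actE ?group1 // conjg1.
Qed.

Lemma trace_map_fixed H a g : H \subset G -> a \in A -> g \in H ->
  trace_map act (H / N) a ^ g = trace_map act (H / N) a.
Proof.
move=> sHG Aa Hg; have Gg := subsetP sHG g Hg.
have [sNG nNG] := andP nsNG.
have nAg := subsetP nAG g Gg; have nNg := subsetP nNG g Gg.
rewrite trace_map_sum // -fmvalJ // (actr_sum g) /=; congr fmval.
rewrite [RHS](reindex_inj (mulIg (coset N g))) /=; apply: eq_big => q.
  by rewrite groupMr // mem_quotient.
case/morphimP=> h nNh Hh ->; have Gh := subsetP sHG h Hh.
by rewrite -fmodJ // -morphM // !coset_actE ?groupM // conjgM.
Qed.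

(** The cosets of N in K are the products q * y ^ i, with q a coset in H and
    i < n, each obtained once. *)
Lemma trace_map_step H y n a :
    N \subset H -> H \subset G -> y \in G -> y \in 'N(H) -> y ^+ n \in H ->
    #|H <*> <[y]> : H| = n -> a \in A ->
  trace_map act ((H <*> <[y]>) / N) a
    = cyclic_norm n y (trace_map act (H / N) a).
Proof.
move=> sNH sHG Gy nHy Hyn; set K := (H <*> <[y]>)%G => iHK Aa.
have [sNG nNG] := andP nsNG.
have sKG : K \subset G by rewrite join_subG sHG cycle_subG.
have sHK : H \subset K := joing_subl _ _.
have n_gt0 : 0 < n by rewrite -iHK indexg_gt0.
have nNy := subsetP nNG y Gy.
pose f (iq : 'I_n * coset_of N) := iq.2 * coset N y ^+ iq.1.
pose D := setX [set: 'I_n] (H / N).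
have sKfD : K / N \subset f @: D.
  apply/subsetP=> _ /morphimP[k _ Kk ->].
  move: Kk; rewrite [gval K]norm_joinEr ?cycle_subG //.
  case/mulsgP=> h _ Hh /cycleP[m ->] ->; set h' := h * (y ^+ n) ^+ (m %/ n).
  have Hh' : h' \in H by rewrite groupM 1?groupX.
  apply/imsetP; exists (Ordinal (ltn_pmod m n_gt0), coset N h').
    by rewrite !inE /= mem_quotient.
  have nNh' : h' \in 'N(N) by rewrite (subsetP nNG) ?(subsetP sHG).
  rewrite /f /= -morphX // -morphM 1?groupX //.
  by rewrite {1}(divn_eq m n) expgD mulnC expgM mulgA.
have cD : #|D| = #|K / N|.
  rewrite cardsX cardsT card_ord !card_quotient ?(subset_trans _ nNG) //.
  by rewrite -(Lagrange_index sHK sNH) iHK.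
have [injf eK] : {in D &, injective f} /\ K / N = f @: D.
  have e1 : #|f @: D| = #|D|.
    have := subset_leq_card sKfD; rewrite -cD => le.
    by apply/eqP; rewrite eqn_leq le andbT leq_imset_card.
  split; first by apply/imset_injP; apply/eqP.
  by apply/eqP; rewrite eqEcard sKfD e1 cD leqnn.
rewrite !trace_map_sum // eK big_imset //= /cyclic_norm.
have -> : \prod_(i < n) fmval (\sum_(q in H / N) fmod abA (act a q))%R ^ y ^+ i
  = fmval (\sum_(i < n) (\sum_(q in H / N) fmod abA (act a q)) ^@ (y ^+ i))%R.
  rewrite [RHS]fmval_sum; apply: eq_bigr => i _.
  by rewrite [RHS]fmvalJ // groupX // (subsetP nAG).
congr fmval; rewrite (eq_bigr (fun i : 'I_n =>
    \sum_(q in H / N) fmod abA (act a (f (i, q))))%R); last first.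
  move=> i _; rewrite (actr_sum (y ^+ i)); apply: eq_bigr.
  move=> _ /morphimP[h nNh Hh ->]; have Gh := subsetP sHG h Hh.
  rewrite -fmodJ ?groupX ?(subsetP nAG) // /f /= -morphX // -morphM ?groupX //.
  by rewrite !coset_actE ?groupM ?groupX // conjgM.
rewrite pair_big_dep /=. apply: eq_big => [[i q]|[i q] _] //.
by rewrite !inE.
Qed.

End TraceTower.

(** * The centre of the Frattini subgroup as a module *)

Lemma pgroup_expg_Phi (p : nat) (gT : finGroupType) (P : {group gT}) (x : gT) :
  p.-group P -> x \in P -> x ^+ p \in 'Phi(P).
Proof.
move=> pP Px; rewrite (Phi_joing pP) (subsetP (joing_subr _ _)) // -[p]expn1.
by apply: Mho_p_elt => //; apply: mem_p_elt pP Px.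
Qed.

Section FrattiniModule.

Variables (p : nat) (gT : finGroupType) (G : {group gT}).
Hypotheses (p_pr : prime p) (pG : p.-group G).
Implicit Types (H : {group gT}) (a g x y : gT).

Local Notation Phi := 'Phi(G).
Local Notation A := 'Z('Phi(G)).
Local Notation trace H :=
  (trace_map ('J %% 'Phi(G))%gact (H / 'Phi(G))).

Lemma ZPhi_normal : A <| G.
Proof. exact: char_normal_trans (center_char _) (Phi_normal G). Qed.

Lemma ZPhi_abelian : abelian A. Proof. exact: center_abelian. Qed.

Lemma ZPhi_cent : A \subset 'C(Phi).
Proof. exact: subsetIr. Qed.

Lemma Phi_cent_ZPhi : Phi \subset 'C(A).
Proof. by rewrite centsC ZPhi_cent. Qed.

Lemma ZPhi_norm g : g \in G -> g \in 'N(A).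
Proof. exact: subsetP (normal_norm ZPhi_normal) g. Qed.

Lemma expg_Phi g : g \in G -> g ^+ p \in Phi.
Proof. exact: pgroup_expg_Phi. Qed.

Lemma der1_Phi : G^`(1) \subset Phi.
Proof. by rewrite (Phi_joing pG) joing_subl. Qed.

Lemma commg_Phi g x : g \in G -> x \in G -> [~ g, x] \in Phi.
Proof. by move=> Gg Gx; rewrite (subsetP der1_Phi) // mem_commg. Qed.

Lemma over_Phi_normal H : Phi \subset H -> H \subset G -> H <| G.
Proof.
by move=> sPH sHG; rewrite (sub_der1_normal _ sHG) // (subset_trans der1_Phi).
Qed.

Lemma Phi_step_index H y :
    Phi \subset H -> H \subset G -> y \in G -> y \notin H ->
  #|H <*> <[y]> : H| = p.
Proof.
move=> sPH sHG Gy H'y; have /andP[_ nHG] := over_Phi_normal sPH sHG.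
have nHy := subsetP nHG y Gy.
have nHK : H <*> <[y]> \subset 'N(H) by rewrite join_subG normG cycle_subG.
rewrite -card_quotient // quotientYidl ?cycle_subG // quotient_cycle //.
apply: nt_prime_order => //.
  by rewrite -morphX //= coset_id // (subsetP sPH) ?expg_Phi.
by apply: contra H'y => /eqP e1; apply: coset_idr.
Qed.

Lemma frattini_index : ~~ abelian G -> p ^ 2 <= #|G : Phi|.
Proof.
move=> nabG; rewrite -card_quotient ?normal_norm ?Phi_normal //.
have abQ := Phi_quotient_abelem pG.
rewrite (card_pgroup (abelem_pgroup abQ)) leq_exp2l ?(prime_gt1 p_pr) // ltnNge.
apply: contra nabG; rewrite -(abelem_cyclic abQ) => cycQ.
exact: cyclic_abelian (Phi_quotient_cyclic cycQ).
Qed.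

(** The vanishing of the Tate group in degree zero: A :&: 'Z(G) is the
    subgroup of fixed points. *)
Definition trace_onto := A :&: 'Z(G) \subset [set trace G a | a in A].

Lemma S_groupI : ~~ abelian G -> ~ trace_onto -> S_group G.
Proof.
move=> nabG not_onto; split=> //.
  exact: pgroup_p pG.
have nPhiG := normal_norm (Phi_normal G).
rewrite /tateH0 gacent_mod //; last by rewrite astabJ Phi_cent_ZPhi.
rewrite gacentJ.
have trM := trace_mapM (Phi_normal G) (normal_norm ZPhi_normal) ZPhi_abelian
                       ZPhi_cent (subxx G).
have eT : trace_image ('J %% 'Phi(G))%gact (G / Phi) A = Morphism trM @* A.
  by rewrite morphimEdom.
rewrite eT => C1; case: not_onto; rewrite /trace_onto.
rewrite -[[set _ | _ in _]]/(trace_image ('J %% 'Phi(G))%gact (G / Phi) A) eT.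
have sTA : Morphism trM @* A \subset A.
  apply/subsetP=> _ /morphimP[a _ Aa ->].
  exact: (trace_map_mem (Phi_normal G) (normal_norm ZPhi_normal)
           ZPhi_abelian ZPhi_cent (subxx G)).
have nTC : 'C_A(G) \subset 'N(Morphism trM @* A).
  apply: subset_trans (subsetIl _ _) (sub_abelian_norm ZPhi_abelian sTA).
apply: subset_trans (_ : 'C_A(G) \subset _); first by rewrite setIS ?subsetIr.
by rewrite -quotient_sub1 // C1.
Qed.

(** * A counting criterion *)

Lemma pgroup_proper_card (B C : {group gT}) :
  p.-group B -> C \proper B -> p * #|C| <= #|B|.
Proof.
move=> pB /andP[sCB nsBC]; rewrite -(Lagrange sCB) mulnC leq_mul2l.
apply/orP; right; have := pnat_dvd (dvdn_indexg B C) pB.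
move/p_natP=> [[|k] ek].
  by case/negP: nsBC; rewrite -indexg_eq1 ek.
by rewrite ek expnS leq_pmulr // expn_gt0 prime_gt0.
Qed.

Let nilG : nilpotent G := pgroup_nil pG.

(** The subgroup A :&: 'C(H) is normal in G because H contains the derived
    subgroup; if it is not central, its image in G / 'Z(G) meets the centre of
    that quotient, that is, it has noncentral elements in the second centre. *)
Lemma layer_cent_sub H :
    Phi \subset H -> H \subset G ->
    A :&: 'Z_2(G) :&: 'C(H) \subset 'Z(G) ->
  A :&: 'C(H) \subset 'Z(G).
Proof.
move=> sPH sHG sWZ; have /andP[_ nHG] := over_Phi_normal sPH sHG.
pose N := (A :&: 'C(H))%G.
have sNG : N \subset G by rewrite subIset // normal_sub ?ZPhi_normal.
have nNG : G \subset 'N(N).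
  by apply: normsI (normal_norm ZPhi_normal) (norms_cent nHG).
have nZG : G \subset 'N('Z(G)) by rewrite normal_norm ?center_normal.
have nsNZ : N / 'Z(G) <| G / 'Z(G) by rewrite quotient_normal // /normal sNG.
rewrite -[_ :&: _]/(gval N) -quotient_sub1 ?(subset_trans sNG) // subG1.
have /= := meet_center_nil (quotient_nil 'Z(G)%G nilG) nsNZ.
case: (N / 'Z(G) =P 1) => // _ /(_ isT).
case/trivgPn=> _ /setIP[/morphimP[n nZn Nn ->]].
rewrite /= -ucn1 -ucn_central ucn1 => Z2n /eqP; case; apply: coset_id.
apply: (subsetP sWZ); have /setIP[An Cn] := Nn.
apply/setIP; split=> //; apply/setIP; split=> //.
case/morphimP: Z2n => m nZm Z2m /rcoset_kercosetP.
move=> /(_ nZn nZm) /rcosetP[z Zz ->].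
by rewrite groupM // (subsetP (ucn_subS 1 G)) // ucn1.
Qed.

(** Take H of largest order among the subgroups over Phi for which
    #|H| * #|W :&: 'C(H)| has not grown.  A noncentral element of W fixed by H
    is moved by some x; adjoining x to H multiplies the first factor by p and
    divides the second by at least p, against maximality. *)
Lemma small_centraliser (W : {group gT}) : W \subset A ->
  exists H : {group gT}, [/\ Phi \subset H, H \subset G,
    W :&: 'C(H) \subset 'Z(G) & #|H| * #|W :&: 'Z(G)| <= #|Phi| * #|W|].
Proof.
move=> sWA; have sAG := normal_sub ZPhi_normal.
pose P (H : {group gT}) := [&& Phi \subset H, H \subset G
  & #|H| * #|W :&: 'C(H)| <= #|Phi| * #|W|].
have P0 : P 'Phi(G)%G.
  by rewrite /P subxx Phi_sub /= leq_mul2l subset_leq_card ?subsetIl ?orbT.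
case: (@arg_maxnP _ 'Phi(G)%G P (fun H => #|H|) P0).
move=> H /and3P[sPH sHG cH] maxH.
have sWCZ : W :&: 'C(H) \subset 'Z(G).
  apply/subsetP=> w /setIP[Ww Cw].
  have Gw : w \in G by rewrite (subsetP sAG) ?(subsetP sWA).
  rewrite inE Gw /=; apply/centP=> x Gx; apply/eqP/idPn=> ncwx.
  have H'x : x \notin H.
    by apply: contra ncwx => Hx; apply/eqP; apply: (centP Cw).
  pose K := (H <*> <[x]>)%G.
  have iK : #|K : H| = p by apply: Phi_step_index.
  have sHK : H \subset K by apply: joing_subl.
  have cK : #|K| = (#|H| * p)%N by rewrite -iK Lagrange.
  have: P K.
    rewrite /P (subset_trans sPH) //= join_subG sHG cycle_subG Gx /=.
    apply: leq_trans cH; rewrite [#|_ <*> _|]cK -mulnA leq_mul2l.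
    apply/orP; right.
    apply: (@pgroup_proper_card (W :&: 'C(H))%G (W :&: 'C(K))%G).
      by apply: pgroupS pG; rewrite subIset // (subset_trans sWA).
    rewrite properE setIS ?centS //=; apply/subsetPn.
    exists w; first by rewrite inE Ww.
    rewrite inE Ww /=; apply: contra ncwx => /centP/(_ x) cx; apply/eqP/cx.
    by rewrite mem_gen // inE cycle_id orbT.
  move/maxH; rewrite /= [#|_ <*> _|]cK; apply/negP; rewrite -ltnNge.
  by rewrite -{1}(muln1 #|H|) ltn_pmul2l ?cardG_gt0 ?prime_gt1.
exists H; split=> //; apply: leq_trans cH.
by rewrite leq_mul2l subset_leq_card ?orbT // setIS // subIset // centS ?orbT.
Qed.

Lemma ZPhi_centre_neq1 : ~~ abelian G -> A :&: 'Z(G) != 1.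
Proof.
move=> nabG; apply: (meet_center_nil nilG ZPhi_normal).
rewrite center_nil_eq1; last exact: nilpotentS (Phi_sub G) nilG.
by rewrite (trivg_Phi pG); apply: contra nabG => /abelem_abelian.
Qed.

Lemma pgroup_sub_Phi_eq1 (E : {group gT}) :
  E \subset 'Phi(E) -> E :=: 1.
Proof.
by move=> sEP; apply/eqP; apply: contraLR sEP => /Phi_proper/andP[].
Qed.

Lemma Phi_joing_index H y : Phi \subset H -> y \in G -> y \notin H ->
  #|G : H| = p -> H \subset G -> H <*> <[y]> = G.
Proof.
move=> sPH Gy H'y iH sHG; apply/eqP.
rewrite eqEcard join_subG sHG cycle_subG Gy /=.
rewrite -(Lagrange sHG) -(@Lagrange _ (H <*> <[y]>) H) ?joing_subl //.
by rewrite Phi_step_index // iH.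
Qed.

Lemma trace_step H y a :
    Phi \subset H -> H \subset G -> y \in G -> y \notin H -> a \in A ->
  trace (H <*> <[y]>) a = cyclic_norm p y (trace H a).
Proof.
move=> sPH sHG Gy H'y Aa; have /andP[_ nHG] := over_Phi_normal sPH sHG.
apply: (trace_map_step (Phi_normal G) (normal_norm ZPhi_normal) ZPhi_abelian
         ZPhi_cent) => //.
- exact: (subsetP nHG).
- by rewrite (subsetP sPH) ?expg_Phi.
- exact: Phi_step_index.
Qed.

Lemma trace_mem H a : H \subset G -> a \in A -> trace H a \in A.
Proof.
move=> sHG; exact: (trace_map_mem (Phi_normal G) (normal_norm ZPhi_normal)
           ZPhi_abelian ZPhi_cent sHG).
Qed.

Lemma trace_cent H a : H \subset G -> a \in A -> trace H a \in A :&: 'C(H).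
Proof.
move=> sHG Aa; rewrite inE trace_mem //=; apply/centP=> h Hh.
apply/commgP/conjg_fixP.
exact: (trace_map_fixed (Phi_normal G) (normal_norm ZPhi_normal)
         ZPhi_abelian ZPhi_cent sHG).
Qed.

(** The hypothesis makes the subgroup H given by [small_centraliser] proper.  A
    maximal subgroup M over H has the same fixed points in A as G, so the trace
    over G takes its values in the p-th powers of A :&: 'Z(G). *)
Theorem layer_not_onto :
    ~~ abelian G ->
    #|A :&: 'Z_2(G)| < #|G : Phi| * #|A :&: 'Z_2(G) :&: 'Z(G)| ->
  ~ trace_onto.
Proof.
move=> nabG ltW onto.
have [|H [sPH sHG sWZ cH]] := @small_centraliser (A :&: 'Z_2(G))%G.
  exact: subsetIl.
have sCZ := layer_cent_sub sPH sHG sWZ.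
have [eHG | [M maxM sHM]] := maximal_exists sHG.
  have: #|G| < #|G|; last by rewrite ltnn.
  rewrite -(ltn_pmul2r (cardG_gt0 (A :&: 'Z_2(G) :&: 'Z(G))%G)) -{1}eHG.
  apply: leq_ltn_trans cH _; rewrite -(Lagrange (Phi_sub G)) -mulnA.
  by rewrite ltn_pmul2l ?cardG_gt0.
have sPM := subset_trans sPH sHM.
have /andP[sMG /subsetPn[y Gy M'y]] := maxgroupp maxM.
have iM := p_maximal_index pG maxM.
pose E := (A :&: 'Z(G))%G.
have pE : p.-group E.
  by apply: pgroupS pG; rewrite subIset // normal_sub ?ZPhi_normal.
case/eqP: (ZPhi_centre_neq1 nabG); apply: (@pgroup_sub_Phi_eq1 E).
apply/subsetP=> _ /(subsetP onto) /imsetP[a Aa ->].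
rewrite -[X in trace_map _ (X / _)](Phi_joing_index sPM Gy M'y iM sMG).
rewrite trace_step //.
have /setIP[AM CM] := trace_cent sMG Aa.
have ZM : trace M a \in 'Z(G).
  by apply: (subsetP sCZ); rewrite inE AM (subsetP (centS sHM)).
rewrite cyclic_norm_cent1; last first.
  by have /setIP[_ /centP cZ] := ZM; apply/cent1P/cZ.
by apply: (pgroup_expg_Phi pE); rewrite inE AM.
Qed.

(** * Two-generator groups *)

Section RankTwo.

Hypothesis rank2 : #|G : Phi| = (p ^ 2)%N.

Lemma rank2_supplement x : x \in G -> x \notin Phi ->
  exists y, [/\ y \in G, y \notin Phi <*> <[x]>,
    (Phi <*> <[x]>) <*> <[y]> = G
    & forall a, a \in A -> trace G a = cyclic_norm p y (cyclic_norm p x a)].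
Proof.
move=> Gx P'x; pose H := (Phi <*> <[x]>)%G.
have sPG := Phi_sub G.
have sPH : Phi \subset H := joing_subl _ _.
have sHG : H \subset G by rewrite join_subG sPG cycle_subG.
have iHP : #|H : Phi| = p by apply: (@Phi_step_index 'Phi(G)%G).
have iGH : #|G : H| = p.
  apply/eqP; rewrite -(eqn_pmul2r (prime_gt0 p_pr)) -{1}iHP.
  by rewrite Lagrange_index // rank2.
have /subsetPn[y Gy H'y] : ~~ (G \subset H).
  by rewrite -indexg_eq1 iGH; case: eqP p_pr => // ->.
have eG : H <*> <[y]> = G by apply: Phi_joing_index.
exists y; split=> // a Aa.
rewrite -[X in trace_map _ (X / _)]eG trace_step //; congr (cyclic_norm _ _ _).
rewrite (@trace_step 'Phi(G)%G) //.
by rewrite (trace_map_base (Phi_normal G) ZPhi_cent).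
Qed.

Lemma cent_supplement x y : (Phi <*> <[x]>) <*> <[y]> = G ->
  'C_('C_A[x])[y] \subset A :&: 'Z(G).
Proof.
move=> eG; apply/subsetP=> a /setIP[/setIP[Aa cax] cay].
rewrite inE Aa /= inE (subsetP (normal_sub ZPhi_normal)) //=.
suff sGC : G \subset 'C[a] by rewrite -sub1set centsC cent_set1.
rewrite -{1}eG !join_subG !cycle_subG.
rewrite [x \in _]cent1C [y \in _]cent1C cax cay !andbT.
apply: subset_trans Phi_cent_ZPhi _.
by rewrite /= -cent_set1 centS ?sub1set.
Qed.

Lemma commg_cent_ZPhi g x : g \in G -> x \in G -> [~ g, x] \in 'C(A).
Proof. by move=> Gg Gx; rewrite (subsetP Phi_cent_ZPhi) ?commg_Phi. Qed.

Lemma cent1_ZPhi_normal x : x \in G -> 'C_A[x] <| G.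
Proof.
move=> Gx; apply/andP; split.
  exact: subset_trans (subsetIl _ _) (normal_sub ZPhi_normal).
apply/subsetP=> g Gg; rewrite inE.
apply/subsetP=> _ /imsetP[a /setIP[Aa cax] ->].
rewrite inE memJ_norm ?ZPhi_norm // Aa /= cent1C.
have cax' : a ^ x = a by apply/conjg_fixP/commgP/cent1P.
apply/cent1P/commute_sym/commgP/conjg_fixP.
rewrite -conjgM (commgC g x) conjgM (conjgM a x) cax'.
apply/conjg_fixP/commgP/commute_sym.
by apply: (centP (commg_cent_ZPhi Gg Gx)); rewrite memJ_norm ?ZPhi_norm.
Qed.

Lemma expg_cent_ZPhi x : x \in G -> x ^+ p \in 'C(A).
Proof. by move=> Gx; rewrite (subsetP Phi_cent_ZPhi) ?expg_Phi. Qed.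

Local Notation Nm x Gx := (cyclic_norm_morphism p ZPhi_abelian (ZPhi_norm Gx)).

Lemma norm_image_normal x (Gx : x \in G) : Nm x Gx @* A <| G.
Proof.
rewrite /normal; apply/andP; split.
  apply: subset_trans (normal_sub ZPhi_normal).
  apply/subsetP=> _ /morphimP[a _ Aa ->].
  by rewrite /= cyclic_norm_mem ?ZPhi_norm.
apply/subsetP=> g Gg; rewrite inE.
apply/subsetP=> _ /imsetP[_ /morphimP[a _ Aa ->] ->].
rewrite /= -(cyclic_norm_conj (A := 'Z('Phi(G))%G)) ?ZPhi_norm //.
  2: exact: commg_cent_ZPhi.
have Aag : a ^ g \in A by rewrite memJ_norm ?ZPhi_norm.
exact: (mem_morphim (Nm x Gx)).
Qed.

(** The fixed points of y in D = 'C_A[x] are the fixed points of G, hence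
    traces, hence norms of y of elements of D: Herbrand's count applies to the
    action of y on D.  Moreover the norm of y sends every element of D to such
    a fixed point. *)
Lemma onto_supplement x y : trace_onto -> x \in G -> y \in G ->
    (Phi <*> <[x]>) <*> <[y]> = G ->
    {in A, forall a, trace G a = cyclic_norm p y (cyclic_norm p x a)} ->
  {in 'C_A[x] , forall d, cyclic_norm p y d = 1 ->
     exists2 e, e \in 'C_A[x] & d = [~ e, y]} /\
  {in 'C_A[x], forall d, exists2 a, a \in A &
     cyclic_norm p y d = cyclic_norm p y (cyclic_norm p x a)}.
Proof.
move=> onto Gx Gy eG trE; pose D := 'C_A[x]%G.
have sDA : D \subset A by apply: subsetIl.
have nAx := ZPhi_norm Gx; have nAy := ZPhi_norm Gy.
have nDy : y \in 'N(D).
  exact: subsetP (normal_norm (cent1_ZPhi_normal Gx)) y Gy.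
have cAx := expg_cent_ZPhi Gx; have cAy := expg_cent_ZPhi Gy.
have abD : abelian D := abelianS sDA ZPhi_abelian.
have fixE c : c \in 'C_D[y] -> exists2 a, a \in A &
    c = cyclic_norm p y (cyclic_norm p x a).
  move/(subsetP (cent_supplement eG)) => /(subsetP onto)/imsetP[a Aa ->].
  by exists a; rewrite ?trE.
have ND a : a \in A -> cyclic_norm p x a \in D.
  by move=> Aa; apply: (cyclic_norm_fixed ZPhi_abelian).
split=> d Dd.
  apply: (cyclic_norm_kernel ZPhi_abelian nAy cAy sDA nDy _ Dd).
  apply/subsetP=> c /fixE[a Aa ->].
  by apply: (mem_morphim (Nm y Gy)); rewrite ?ND // (subsetP sDA) ?ND.
apply: fixE; apply: (cyclic_norm_fixed abD) => //.
by apply: subsetP (centS sDA) _ cAy.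
Qed.

(** Let B be the image of the norm of x.  Elements of 'C_A[x] agree with
    elements of B up to the kernel of the norm of y, which consists of
    commutators [~ e, y] with e in 'C_A[x]; nilpotency removes these. *)
Lemma onto_cyclic_norm x : trace_onto -> x \in G -> x \notin Phi ->
  {in 'C_A[x], forall d, exists2 a, a \in A & d = cyclic_norm p x a}.
Proof.
move=> onto Gx P'x d Dd.
have [y [Gy _ eG trE]] := rank2_supplement Gx P'x.
have [h90 lift] := onto_supplement onto Gx Gy eG trE.
suffices: 'C_A[x] \subset Nm x Gx @* A.
  by move/subsetP/(_ d Dd)/morphimP=> [a _ Aa ->]; exists a.
have nsDG := cent1_ZPhi_normal Gx.
apply: (nilpotent_supplement_sub nilG (norm_image_normal Gx) nsDG).
apply/subsetP=> u Du; have [a Aa Nua] := lift u Du.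
have Dv : cyclic_norm p x a \in 'C_A[x].
  exact: (cyclic_norm_fixed ZPhi_abelian (ZPhi_norm Gx) (expg_cent_ZPhi Gx)).
have [e De uE] :
    exists2 e, e \in 'C_A[x] & (cyclic_norm p x a)^-1 * u = [~ e, y].
  apply: h90; first by rewrite groupM ?groupV.
  have [Av _] := setIP Dv; have [Au _] := setIP Du.
  rewrite (cyclic_normM p ZPhi_abelian (ZPhi_norm Gy)) ?groupV //.
  by rewrite (morphV (Nm y Gy)) //= -Nua mulVg.
rewrite -(mulKVg (cyclic_norm p x a) u) uE mem_mulg ?mem_commg //.
exact: (mem_morphim (Nm x Gx)).
Qed.

(** The trace has image A :&: 'Z(G), so it suffices that its kernel lies in
    [~: A, G].  If the norm of y kills the norm of a under x, then the latter
    is a commutator with y of a norm of x, so a differs from a commutator with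
    y by an element killed by the norm of x, which is a commutator with x. *)
Lemma onto_coinvariants :
  trace_onto -> #|A| <= #|A :&: 'Z(G)| * #|[~: A, G]|.
Proof.
move=> onto.
have /subsetPn[x Gx P'x] : ~~ (G \subset Phi).
  rewrite -indexg_eq1 rank2 -(exp1n 2) eqn_exp2r //.
  by case: eqP p_pr => // ->.
have [y [Gy _ eG trE]] := rank2_supplement Gx P'x.
have [h90 _] := onto_supplement onto Gx Gy eG trE.
have trM := trace_mapM (Phi_normal G) (normal_norm ZPhi_normal) ZPhi_abelian
                       ZPhi_cent (subxx G).
pose f := Morphism trM.
have imf : f @* A \subset A :&: 'Z(G).
  apply/subsetP=> _ /morphimP[a _ Aa ->] /=.
  have /setIP[A1 C1] := trace_cent (subxx G) Aa.
  by rewrite inE A1 inE C1 (subsetP (normal_sub ZPhi_normal)).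
have kerf : 'ker_A f \subset [~: A, G].
  apply/subsetP=> a /setIP[Aa /mker /=]; rewrite trE // => tr1.
  have nAx := ZPhi_norm Gx; have nAy := ZPhi_norm Gy.
  have Da := cyclic_norm_fixed ZPhi_abelian nAx (expg_cent_ZPhi Gx) Aa.
  have [e De Ne] := h90 _ Da tr1.
  have [a1 Aa1 eE] := onto_cyclic_norm onto Gx P'x De.
  have Aa1y : [~ a1, y] \in A by rewrite commg_mem.
  have N1 : cyclic_norm p x (a * [~ a1, y]^-1) = 1.
    rewrite (cyclic_normM p ZPhi_abelian nAx) ?groupV //.
    rewrite (morphV (Nm x Gx)) //= (cyclic_norm_commg p ZPhi_abelian nAx) //.
      by rewrite Ne eE mulgV.
    exact: commg_cent_ZPhi.
  have sC : 'C_A[x] \subset Nm x Gx @* A.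
    apply/subsetP=> d /(onto_cyclic_norm onto Gx P'x)[a2 Aa2 ->].
    exact: (mem_morphim (Nm x Gx)).
  have Am : a * [~ a1, y]^-1 \in A by rewrite groupM ?groupV.
  have [a2 Aa2 E] := cyclic_norm_kernel ZPhi_abelian nAx (expg_cent_ZPhi Gx)
    (subxx A) nAx sC Am N1.
  by rewrite -(mulgKV [~ a1, y] a) E groupM ?mem_commg.
have <- : (#|'ker_A f| * #|f @* A|)%N = #|A|.
  by rewrite card_morphim setIid LagrangeI.
by rewrite mulnC leq_mul ?subset_leq_card.
Qed.

End RankTwo.

(** * Metacyclic groups *)

Lemma layer_centre : A :&: 'Z_2(G) :&: 'Z(G) = A :&: 'Z(G).
Proof.
rewrite -setIA; congr (_ :&: _); apply/setIidPr.
by have := ucn_subS 1 G; rewrite ucn1.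
Qed.

Lemma layer_centre_gt1 : ~~ abelian G -> 1 < #|A :&: 'Z_2(G) :&: 'Z(G)|.
Proof. by move=> nabG; rewrite layer_centre cardG_gt1 ZPhi_centre_neq1. Qed.

(** The p-th power of an element of the second centre in A is central, since
    [~ w ^+ p, g] = [~ w, g ^+ p]. *)
Lemma cyclic_layer_card :
  cyclic A -> #|A :&: 'Z_2(G)| <= p * #|A :&: 'Z_2(G) :&: 'Z(G)|.
Proof.
move=> cycA; have /cyclicP[w eW] := cyclicS (subsetIl A 'Z_2(G)) cycA.
have Ww : w \in A :&: 'Z_2(G) by rewrite eW cycle_id.
have [Aw Zw] := setIP Ww.
have Gw := subsetP (normal_sub ZPhi_normal) w Aw.
have Zwp : w ^+ p \in 'Z(G).
  rewrite inE groupX //=; apply/centP=> g Gg; apply/commgP.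
  have Zwg : [~ w, g] \in 'Z(G).
    by rewrite -ucn1 (subsetP (ucn_comm 1 G)) ?mem_commg.
  have [_ /centP cwg] := setIP Zwg.
  rewrite commXg; last exact/commute_sym/cwg.
  rewrite -commgX; last exact/commute_sym/cwg.
  by apply/commgP/commute_sym; apply: (centP (expg_cent_ZPhi Gg)).
apply: leq_trans (_ : p * #|<[w ^+ p]>| <= _); last first.
  rewrite leq_mul2l subset_leq_card ?orbT // cycle_subG inE Zwp andbT.
  exact: groupX.
rewrite eW -!orderE orderXgcd -{1}(divnK (dvdn_gcdl #[w] p)) mulnC.
by rewrite leq_mul2r dvdn_leq ?orbT ?prime_gt0 ?dvdn_gcdr.
Qed.

Lemma cyclic_norm_class2 n x w :
    commute x [~ w, x] -> commute w [~ w, x] ->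
  exists m, cyclic_norm n x w = w ^+ n * [~ w, x] ^+ m.
Proof.
move=> cx cw; elim: n => [|n [m IHn]].
  by exists 0; rewrite /cyclic_norm big_ord0 mulg1.
exists (m + n); rewrite cyclic_normS IHn conjg_mulR commgX //.
have cwm : commute w ([~ w, x] ^+ m) by apply: commuteX.
by rewrite expgSr expgD !mulgA -(mulgA _ _ w) -cwm !mulgA.
Qed.

(** With K = <[a]> the cyclic normal subgroup and D = 'C_A[a], all commutators
    [~ w, a] with w in A lie in K and have order dividing p.  There are thus
    at most p of them, so D has index at most p in A; and D is the image of
    the norm of a, whose kernel therefore has order at most p.  On D this norm
    is the p-th power map, hence #|D : 'Phi(D)| <= p. *)
Theorem metacyclic_not_onto : ~~ abelian G -> metacyclic G -> ~ trace_onto.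
Proof.
move=> nabG /metacyclicP[K [/cyclicP[a eK] nsKG /cyclicP[bK ebK]]].
have [sKG nKG] := andP nsKG.
have Ga : a \in G by rewrite -cycle_subG -eK.
have /morphimP[b nKb Gb ebb] : bK \in G / K by rewrite ebK cycle_id.
have eG : K <*> <[b]> = G.
  apply/eqP; rewrite eqEsubset join_subG sKG cycle_subG Gb /=.
  rewrite -(quotientSGK nKG) ?joing_subl // ebK ebb quotientYidl ?cycle_subG //.
  by rewrite mem_quotient ?cycle_id.
have P'a : a \notin Phi.
  apply: contra nabG => Pa; have sKP : K \subset Phi by rewrite eK cycle_subG.
  apply: cyclic_abelian.
  rewrite -(@Phi_nongen _ G <[b]>) ?genGid ?cycle_cyclic //; apply/eqP.
  rewrite eqEsubset join_subG Phi_sub cycle_subG Gb.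
  by rewrite -{1}eG genS // setSU.
have rank2 : #|G : Phi| = (p ^ 2)%N.
  pose H := (Phi <*> <[a]>)%G.
  have sPH : Phi \subset H := joing_subl _ _.
  have sHG : H \subset G by rewrite join_subG Phi_sub cycle_subG.
  have eHG : H <*> <[b]> = G.
    apply/eqP; rewrite eqEsubset join_subG sHG cycle_subG Gb -{1}eG genS //.
    by rewrite setSU // eK joing_subr.
  have iHP : #|H : Phi| = p.
    by apply: (@Phi_step_index 'Phi(G)%G); rewrite ?Phi_sub.
  have H'b : b \notin H.
    apply: contraL (frattini_index nabG) => Hb.
    have sGH : G \subset H by rewrite -eHG join_subG subxx cycle_subG.
    rewrite -ltnNge; apply: leq_ltn_trans (_ : #|H : Phi| < _).
      rewrite -(leq_pmul2l (cardG_gt0 'Phi(G)%G)) !Lagrange ?Phi_sub //.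
      exact: subset_leq_card.
    by rewrite iHP -[X in X < _]expn1 ltn_exp2l ?prime_gt1.
  by rewrite -(Lagrange_index sHG sPH) iHP -{1}eHG Phi_step_index // mulnn.
move=> onto; apply: layer_not_onto (nabG) _ (onto).
have sAG := normal_sub ZPhi_normal; have nAa := ZPhi_norm Ga.
have cAa := expg_cent_ZPhi Ga.
pose D := 'C_A[a]%G.
have sDA : D \subset A by apply: subsetIl.
have pA : p.-group A := pgroupS sAG pG.
have pD : p.-group D := pgroupS sDA pA.
have commK w : w \in A ->
    [/\ [~ w, a] \in A, [~ w, a] \in K & [~ w, a] ^+ p = 1].
  move=> Aw; have Awa : [~ w, a] \in A by rewrite commg_mem.
  have Kwa : [~ w, a] \in K.
    have Ka : a \in K by rewrite eK cycle_id.
    rewrite commgEr groupM // memJ_norm ?groupV //.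
    by rewrite (subsetP nKG) ?(subsetP sAG).
  have cwa : commute a [~ w, a].
    by move: Kwa; rewrite eK => /cycleP[i ->]; apply: commuteX.
  split=> //; rewrite -commgX //; apply/eqP/commgP.
  by apply: commute_sym; apply: (centP cAa).
have order_p w : w \in A -> #|<[ [~ w, a] ]>| <= p.
  case/commK=> _ _ wp; rewrite -orderE dvdn_leq ?prime_gt0 //.
  by rewrite order_dvdn wp.
have cardA : #|A| <= p * #|D|.
  rewrite -(card_commg ZPhi_abelian nAa (subxx _)) mulnC leq_mul2r.
  apply/orP; right; set I := _ @* _.
  have sIK : I \subset K by apply/subsetP=> _ /morphimP[w _ /commK[_ Kw _] ->].
  have /cyclicP[z eI] : cyclic I.
    by apply: cyclicS sIK _; rewrite eK cycle_cyclic.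
  have : z \in I by rewrite eI cycle_id.
  by case/morphimP=> w _ Aw /= ez; rewrite eI ez order_p.
pose f := cyclic_norm_morphism p ZPhi_abelian nAa.
have eD : f @* A = D.
  apply/eqP; rewrite eqEsubset; apply/andP; split; apply/subsetP=> d.
    by case/morphimP=> w _ Aw ->; apply: (cyclic_norm_fixed ZPhi_abelian).
  case/(onto_cyclic_norm rank2 onto Ga P'a)=> w Aw ->.
  exact: (mem_morphim f).
have cardD : #|D| <= p * #|'Phi(D)|.
  rewrite -(card_cyclic_norm p ZPhi_abelian nAa sDA) leq_mul //.
    apply: leq_trans (_ : #|'ker_A f| <= p).
      by rewrite subset_leq_card ?setSI.
    rewrite -(leq_pmul2r (cardG_gt0 D)) -{1}eD.
    by rewrite (card_cyclic_norm p ZPhi_abelian nAa (subxx _)).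
  rewrite subset_leq_card //; apply/subsetP=> _ /morphimP[d _ Dd ->] /=.
  have /setIP[_ cda] := Dd.
  by rewrite cyclic_norm_cent1 // (pgroup_expg_Phi pD).
have gt1 := layer_centre_gt1 nabG.
have p2_gt0 : 0 < (p ^ 2)%N by rewrite expn_gt0 prime_gt0.
rewrite rank2; have [leDp | ltpD] := leqP #|D| p.
  apply: leq_ltn_trans (_ : (p ^ 2)%N < _); last first.
    by rewrite -{1}[(p ^ 2)%N]muln1 ltn_pmul2l.
  apply: leq_trans (subset_leq_card (subsetIl _ _)) _.
  by apply: leq_trans cardA _; rewrite -mulnn leq_mul2l leDp orbT.
(* The norm of w is w ^+ p times a power of z = [~ w, a].  If z were outside
   'Phi(D), it would generate D, which has more than p elements. *)
have sDPhi : D \subset 'Phi(A).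
  rewrite -eD; apply/subsetP=> _ /morphimP[w _ Aw ->] /=.
  have [Az Kz zp] := commK w Aw; set z := [~ w, a] in Az Kz zp.
  have caz : commute a z.
    by move: Kz; rewrite eK => /cycleP[i ->]; apply: commuteX.
  have [|m ->] := @cyclic_norm_class2 p a w caz.
    by apply: (centsP ZPhi_abelian).
  have Dz : z \in D by rewrite inE Az; apply/cent1P.
  rewrite groupM ?(pgroup_expg_Phi pA) // groupX // (subsetP (PhiS pA sDA)) //.
  apply: contraLR ltpD => P'z; rewrite -leqNgt.
  have eDz : 'Phi(D) <*> <[z]> = D.
    apply/eqP; rewrite eqEcard join_subG Phi_sub cycle_subG Dz /=.
    apply: leq_trans cardD _.
    apply: (@pgroup_proper_card ('Phi(D) <*> <[z]>)%G 'Phi(D)%G).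
      by apply: pgroupS pD; rewrite join_subG Phi_sub cycle_subG.
    rewrite properE joing_subl /=; apply: contra P'z => /subsetP; apply.
    by rewrite mem_gen // inE cycle_id orbT.
  by have /= <- := Phi_nongen eDz; rewrite genGid order_p.
(* As D has index at most p in A, so has 'Phi(A). *)
have cycA : cyclic A.
  apply: Phi_quotient_cyclic; rewrite (abelem_cyclic (Phi_quotient_abelem pA)).
  have le : #|A / 'Phi(A)| <= p.
    rewrite card_quotient ?normal_norm ?Phi_normal //.
    rewrite -(leq_pmul2l (cardG_gt0 'Phi(A)%G)) Lagrange ?Phi_sub // mulnC.
    by apply: leq_trans cardA _; rewrite leq_mul2l subset_leq_card ?orbT.
  rewrite -(leq_exp2l _ _ (prime_gt1 p_pr)) -card_pgroup ?expn1 //.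
  exact: quotient_pgroup.
apply: leq_ltn_trans (cyclic_layer_card cycA) _.
by rewrite ltn_pmul2r ?(ltnW gt1) // -[X in X < _]expn1 ltn_exp2l ?prime_gt1.
Qed.

End FrattiniModule.

(** * Orders and nilpotency class *)

Section ClassBounds.

Variables (p : nat) (gT : finGroupType) (G : {group gT}).
Hypotheses (p_pr : prime p) (pG : p.-group G).

(** The lower central series decreases strictly, by a factor of at least p,
    from the derived subgroup down to the trivial group. *)
Lemma class_leq_der1 : p ^ (nil_class G).-1 <= #|G^`(1)|.
Proof.
have nilG := pgroup_nil pG.
have chain j : j <= nil_class G -> p ^ j <= #|'L_(nil_class G - j).+1(G)|.
  elim: j => [|j IHj] ltjc; first by rewrite cardG_gt0.
  have := IHj (ltnW ltjc); rewrite -[nil_class G - j]prednK ?subn_gt0 //.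
  rewrite -subnS => le; rewrite expnS.
  apply: leq_trans (leq_mul (leqnn p) le) _.
  set i := nil_class G - j.+1.
  have ltic : i < nil_class G by rewrite -(subnKC ltjc) addSn ltnS leq_addl.
  apply: (@pgroup_proper_card _ _ p_pr 'L_i.+1(G)%G 'L_i.+2(G)%G).
    exact: pgroupS (lcn_sub _ _) pG.
  rewrite properE lcn_subS /=; apply: contraL ltic => sLL.
  rewrite -leqNgt; apply/(lcn_nil_classP _ nilG)/eqP.
  have /forallP/(_ 'L_i.+1(G)%G)/implyP := nilG; apply.
  by rewrite subsetI lcn_sub.
case ec: (nil_class G) => [|c]; first by rewrite cardG_gt0.
by have := chain c; rewrite ec leqnSn subSnn lcn2; apply.
Qed.

Lemma quotient_class_leq (W : {group gT}) :
  W <| G -> W \subset 'Z_2(G) -> nil_class G <= (nil_class (G / W)).+2.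
Proof.
move=> /andP[_ nWG] sWZ; have nilG := pgroup_nil pG.
set c := nil_class (G / W); apply/(lcn_nil_classP _ nilG).
have L1 : 'L_c.+1(G / W) = 1.
  exact/(lcn_nil_classP _ (quotient_nil W nilG)).
have sLW : 'L_c.+1(G) \subset W.
  rewrite -quotient_sub1 ?(subset_trans (lcn_sub _ _)) //.
  by rewrite [_ / _](morphim_lcn (coset_morphism W)) // -L1.
apply/trivgP; rewrite -(ucn0 G); apply: subset_trans (ucn_comm 0 G).
rewrite [gval _]lcnSn commSg //; apply: subset_trans (ucn_comm 1 G).
by rewrite lcnSn commSg // (subset_trans sLW).
Qed.

End ClassBounds.

(** The class of G / W is at least that of G minus two, which bounds the order
    of its derived subgroup from below; the abelianisation of G / W has at
    least #|G : 'Phi(G)| >= p ^ 2 elements. *)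
Lemma layer_card_leq (p : nat) (gT : finGroupType) (G W : {group gT}) :
    prime p -> p.-group G -> ~~ abelian G ->
    W <| G -> W \subset 'Z_2(G) -> W \subset 'Phi(G) ->
  #|W| * p ^ (nil_class G).-1 <= #|G|.
Proof.
move=> p_pr pG nabG nsWG sWZ sWP; have [sWG nWG] := andP nsWG.
rewrite -(Lagrange sWG) leq_mul2l; apply/orP; right.
rewrite -card_quotient // -(Lagrange (der_sub 1 (G / W))).
have leP : p ^ 2 <= #|G / W : (G / W)^`(1)|.
  apply: leq_trans (frattini_index p_pr pG nabG) _.
  rewrite -(@index_quotient_eq _ G W 'Phi(G)%G) ?Phi_sub ?subIset ?sWP ?orbT //.
  rewrite -(leq_pmul2l (cardG_gt0 ('Phi(G) / W)%G)) Lagrange;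
    last by rewrite quotientS ?Phi_sub.
  rewrite -{1}(Lagrange (der_sub 1 (G / W))) leq_mul2r subset_leq_card ?orbT //.
  by rewrite /= -quotient_der // quotientS // (der1_Phi pG).
apply: leq_trans (leq_mul (class_leq_der1 p_pr (quotient_pgroup W pG)) leP).
rewrite -expnD leq_exp2l ?prime_gt1 //.
rewrite addn2 -subn1 leq_subLR.
apply: leq_trans (quotient_class_leq pG nsWG sWZ) _.
by rewrite add1n !ltnS leqSpred.
Qed.

(** * 2-groups of coclass two *)

(** A weak form of Taussky's theorem.  Here the derived subgroup is 'Phi(G), and
    L = [~: G^`(1), G] has index 2 in it.  If all squares of elements outside
    'Phi(G) were in L, two generators would commute modulo L.  So some u outside
    'Phi(G) satisfies G^`(1) = L <[u ^+ 2]>.  Put M = <[u]> G^`(1); since u ^+ 2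
    lies in 'Phi(M), nilpotency gives G^`(1) \subset 'Phi(M).  Then u generates
    M modulo 'Phi(M), and M is a cyclic subgroup of index at most 2. *)
Lemma der1_index4_metacyclic (gT : finGroupType) (G : {group gT}) :
  2.-group G -> ~~ abelian G -> #|G : G^`(1)| <= 4 -> metacyclic G.
Proof.
move=> pG nabG le4; have p_pr : prime 2 by [].
have nilG := pgroup_nil pG.
have le4P := frattini_index p_pr pG nabG.
have sG'P := der1_Phi pG; have sPG := Phi_sub G.
have sG'G := der_sub 1 G.
have eG'P : G^`(1) = 'Phi(G).
  apply/eqP; rewrite eqEcard sG'P /=.
  rewrite -(leq_pmul2r (isT : 0 < 4)) (leq_trans (leq_mul (leqnn _) le4P)) //.
  by rewrite Lagrange // -(Lagrange sG'G) leq_mul2l le4 orbT.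
have iP : #|G : 'Phi(G)| = (2 ^ 2)%N.
  by apply/eqP; rewrite eqn_leq le4P andbT -eG'P.
pose L := 'L_3(G)%G.
have eL : L :=: [~: G^`(1), G] by rewrite /= lcnSn lcn2.
have [sLG nLG] := andP (lcn_normal 3 G).
have sLG' : L \subset G^`(1) by rewrite -lcn2 lcn_subS.
have nsG'L : ~~ (G^`(1) \subset L).
  apply: contra nabG; rewrite eL => sG'.
  have /forallP/(_ (G^`(1))%G)/implyP := nilG.
  by rewrite subsetI sG'G => /(_ sG')/eqP/derG1P.
have /subsetPn[x Gx P'x] : ~~ (G \subset 'Phi(G)).
  by rewrite -indexg_eq1 iP.
have [y [Gy H'y eG _]] := rank2_supplement p_pr pG iP Gx P'x.
have eXY : <[x]> <*> <[y]> = G.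
  have /Phi_nongen : 'Phi(G) <*> (<[x]> <*> <[y]>) = G by rewrite joingA.
  by rewrite genGid.
have nLx := subsetP nLG x Gx; have nLy := subsetP nLG y Gy.
have eXYq : <[coset L x]> <*> <[coset L y]> = G / L.
  by rewrite -!quotient_cycle // -quotientY ?cycle_subG // eXY.
have [u [Gu P'u L'u]] :
    exists u, [/\ u \in G, u \notin 'Phi(G) & u ^+ 2 \notin L].
  have P'y : y \notin 'Phi(G).
    by apply: contra H'y; apply: subsetP (joing_subl _ _) y.
  have P'xy : x * y \notin 'Phi(G).
    apply: contra H'y => Pxy; rewrite -(mulKg x y).
    have Hx : x \in 'Phi(G) <*> <[x]> by rewrite mem_gen // inE cycle_id orbT.
    by rewrite groupM ?groupV // (subsetP (joing_subl _ _)).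
  have [Lx | L'x] := boolP (x ^+ 2 \in L); last by exists x.
  have [Ly | L'y] := boolP (y ^+ 2 \in L); last by exists y.
  have [Lxy | L'xy] := boolP ((x * y) ^+ 2 \in L); last first.
    by exists (x * y); rewrite groupM.
  case/negP: nsG'L; rewrite der1_min // -eXYq abelianY !cycle_abelian /=.
  rewrite cycle_subG /= cent_cycle; apply/cent1P.
  have sq z : z \in G -> z ^+ 2 \in L -> (coset L z)^-1 = coset L z.
    move=> Gz Lz; apply/eqP.
    rewrite eq_invg_mul -[_ * _]/(coset L z ^+ 2) -morphX ?(subsetP nLG) //=.
    by rewrite coset_id.
  by have := sq _ (groupM Gx Gy) Lxy; rewrite morphM //= invMg !sq.
have nLG' : G^`(1) \subset 'N(L) := subset_trans sG'G nLG.
have cG'L : G^`(1) / L \subset 'Z(G / L).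
  by have := lcn_central 2 G; rewrite lcn2.
(* Modulo L the derived subgroup is generated by the central element [~ x, y],
   whose square is [~ x ^+ 2, y] = 1. *)
have cardG' : #|G^`(1)| <= 2 * #|L|.
  rewrite -(Lagrange sLG') mulnC leq_mul2r -card_quotient // quotient_der //.
  apply/orP; right; rewrite -eXYq.
  have Zxy : [~ coset L x, coset L y] \in 'Z(G / L).
    apply: (subsetP cG'L).
    by rewrite -morphR // mem_quotient // mem_commg.
  have := Zxy; rewrite -{1}eXYq => /setIP[_ Cxy].
  rewrite der1_joing_cycles // -orderE dvdn_leq // order_dvdn.
  have cx : commute (coset L x) [~ coset L x, coset L y].
    have /setIP[_ /centP cZ] := Zxy; apply/commute_sym/cZ.
    exact: mem_quotient.
  rewrite -commXg //; apply/commgP.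
  have : coset L x ^+ 2 \in 'Z(G / L).
    apply: (subsetP cG'L); rewrite -morphX // mem_quotient //= eG'P.
    exact: (expg_Phi pG).
  by case/setIP=> _ /centP; apply; apply: mem_quotient.
have G'u2 : u ^+ 2 \in G^`(1) by rewrite eG'P (expg_Phi pG).
have pG' : 2.-group (L <*> <[u ^+ 2]>).
  by apply: pgroupS pG; rewrite join_subG sLG cycle_subG groupX.
have eG' : L <*> <[u ^+ 2]> = G^`(1).
  apply/eqP; rewrite eqEcard join_subG sLG' cycle_subG G'u2 /=.
  apply: leq_trans cardG' _; apply: (pgroup_proper_card _ pG') => //.
  rewrite properE joing_subl /=; apply: contra L'u => /subsetP; apply.
  by rewrite mem_gen // inE cycle_id orbT.
pose M := (<[u]> <*> G^`(1))%G.
have sMG : M \subset G by rewrite join_subG cycle_subG Gu.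
have nsMG : M <| G by apply: sub_der1_normal; rewrite ?joing_subr.
have pM : 2.-group M := pgroupS sMG pG.
have Mu : u \in M by rewrite mem_gen // inE cycle_id.
have nsPMG : 'Phi(M) <| G := char_normal_trans (Phi_char M) nsMG.
have sG'PM : G^`(1) \subset 'Phi(M).
  apply: (nilpotent_supplement_sub nilG nsPMG (der_normal 1 G)).
  apply: subset_trans (_ : L <*> <[u ^+ 2]> \subset _); first by rewrite eG'.
  rewrite /= -eL -norm_joinEr; last first.
    exact: subset_trans sLG (normal_norm nsPMG).
  rewrite join_subG joing_subr cycle_subG /=.
  by apply: (subsetP (joing_subl _ _)); apply: pgroup_expg_Phi.
have cycM : cyclic M.
  have /Phi_nongen : 'Phi(M) <*> <[u]> = M.
    apply/eqP; rewrite eqEsubset join_subG Phi_sub cycle_subG Mu /=.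
    by rewrite join_subG joing_subr (subset_trans sG'PM) ?joing_subl.
  by rewrite genGid => <-; apply: cycle_cyclic.
apply/metacyclicP; exists M; split=> //.
have sG'M : G^`(1) \subset M := joing_subr _ _.
have le2 : #|G : M| <= 2.
  rewrite -(leq_pmul2r (isT : 0 < 2)); apply: leq_trans le4.
  rewrite -(Lagrange_index sMG sG'M) leq_mul2l; apply/orP; right.
  rewrite -(leq_pmul2l (cardG_gt0 (G^`(1))%G)) Lagrange // mulnC.
  apply: (pgroup_proper_card _ pM) => //; rewrite properE sG'M /=.
  by apply: contra P'u => /subsetP/(_ u Mu); rewrite eG'P.
rewrite -card_quotient ?normal_norm // in le2.
have [le1 | gt1] := leqP #|G / M| 1.
  by rewrite (card_le1_trivg le1) cyclic1.
apply: prime_cyclic; suff -> : #|G / M| = 2 by [].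
by apply/eqP; rewrite eqn_leq le2.
Qed.

Lemma nat2_gt4_geq8 n : 2.-nat n -> 4 < n -> 8 <= n.
Proof.
case/p_natP=> k ->; rewrite (ltn_exp2l 2 k (isT : 1 < 2)).
by rewrite (leq_exp2l 3 k (isT : 1 < 2)).
Qed.

(** The numerical conditions left open by [layer_not_onto] determine #|W|,
    #|W :&: 'Z(G)| and #|G : 'Phi(G)|; the contradiction is that [~: A, G] has
    index at most 2 in A, and at least 4 once A = W. *)
Theorem coclass2_not_onto (gT : finGroupType) (G : {group gT}) :
    2.-group G -> ~~ abelian G -> coclass 2 G = 2 -> ~ trace_onto G.
Proof.
move=> pG nabG cocl onto; have p_pr : prime 2 by [].
have nilG := pgroup_nil pG.
have [le4 | gt4] := leqP #|G : G^`(1)| 4.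
  have metaG := der1_index4_metacyclic pG nabG le4.
  exact: (metacyclic_not_onto p_pr pG nabG metaG) onto.
have sG'G := der_sub 1 G.
have ge8 : 8 <= #|G : G^`(1)|.
  exact: nat2_gt4_geq8 (pnat_dvd (dvdn_indexg _ _) pG) gt4.
set c := nil_class G.
have cardG : #|G| = (2 ^ c.+2)%N.
  rewrite {1}(card_pgroup pG); congr (_ ^ _)%N.
  rewrite -(@subnK c (logn 2 _)) -/(coclass 2 G) ?cocl //.
  by rewrite ltnW // -subn_gt0 -/(coclass 2 G) cocl.
have c_gt1 : 1 < c by rewrite ltnNge nil_class1.
have cardG' : #|G^`(1)| * 8 <= 2 ^ c.+2.
  by rewrite -cardG -(Lagrange sG'G) leq_mul2l ge8 orbT.
pose A := 'Z('Phi(G))%G; pose W := (A :&: 'Z_2(G))%G.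
have sWA : W \subset A := subsetIl _ _.
have sWZ : W \subset 'Z_2(G) := subsetIr _ _.
have nsAG : A <| G := ZPhi_normal G.
have nsWG : W <| G by apply: normalI; rewrite ?ucn_normal.
have sWP : W \subset 'Phi(G) := subset_trans sWA (center_sub _).
have leW : #|W| <= 8.
  rewrite -(leq_pmul2r (expn_gt0 2 c.-1 : 0 < _)).
  apply: leq_trans (layer_card_leq p_pr pG nabG nsWG sWZ sWP) _.
  by rewrite cardG -(expnD 2 3) leq_exp2l // -(prednK (ltnW c_gt1)).
pose z := #|W :&: 'Z(G)|.
have z_gt1 : 1 < z := layer_centre_gt1 pG nabG.
have P4 := frattini_index p_pr pG nabG.
have geW : #|G : 'Phi(G)| * z <= #|W|.
  rewrite leqNgt; apply/negP=> lt.
  exact: (layer_not_onto p_pr pG nabG lt onto).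
have [eP ez eW] : [/\ #|G : 'Phi(G)| = 4, z = 2 & #|W| = 8].
  have le8 := leq_trans geW leW.
  have ez : z = 2.
    apply/eqP; rewrite eqn_leq z_gt1 andbT -(leq_pmul2l (isT : 0 < 4)).
    by apply: leq_trans le8; rewrite leq_mul2r P4 orbT.
  have eP : #|G : 'Phi(G)| = 4.
    by apply/eqP; rewrite eqn_leq P4 andbT -(leq_pmul2r (isT : 0 < 2)) -{1}ez.
  split=> //; apply/eqP; rewrite eqn_leq leW /=.
  by move: geW; rewrite eP ez.
have cardA : #|A| <= 2 * #|[~: A, G]|.
  by have := onto_coinvariants p_pr pG eP onto; rewrite -layer_centre -/z ez.
(* Otherwise the derived subgroup of G / W would have at most 2 ^ (c - 4)
   elements, while the class of G / W is at least c - 2. *)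
have nsWG' : ~~ (W \subset G^`(1)).
  apply/negP=> sWG'.
  have := class_leq_der1 p_pr (quotient_pgroup W pG).
  rewrite -quotient_der ?normal_norm // card_quotient; last first.
    exact: subset_trans sG'G (normal_norm nsWG).
  rewrite leqNgt => /negP; apply.
  rewrite -(ltn_pmul2l (isT : 0 < 8)) -{1}eW Lagrange //.
  rewrite -(ltn_pmul2r (isT : 0 < 8)); apply: leq_ltn_trans cardG' _.
  rewrite mulnAC mulnC -(expnD 2 3 3) -expnD ltn_exp2l // addnC.
  have := quotient_class_leq pG nsWG sWZ; rewrite -/c => le.
  apply: leq_ltn_trans (_ : (nil_class (G / W)).+4 < _); first by rewrite !ltnS.
  by rewrite !addSn add0n !ltnS leqSpred.
have sAG' : [~: A, G] \subset G^`(1) by rewrite commSg ?normal_sub.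
have sAA : [~: A, G] \subset A by rewrite commg_subl normal_norm.
have pA : 2.-group A := pgroupS (normal_sub nsAG) pG.
(* [~: A, G] has index at most 2 in A and does not contain W. *)
have eA : W <*> [~: A, G] = A.
  apply/eqP; rewrite eqEcard join_subG sWA sAA /=.
  apply: leq_trans cardA _.
  apply: (@pgroup_proper_card _ _ _ (W <*> [~: A, G])%G [~: A, G]%G) => //.
    by apply: pgroupS pA; rewrite join_subG sWA.
  rewrite properE joing_subr /=; apply: contra nsWG' => sW.
  exact: subset_trans (subset_trans (joing_subl _ _) sW) sAG'.
have sAW : A \subset W.
  apply: (nilpotent_supplement_sub nilG nsWG nsAG).
  rewrite -norm_joinEr ?eA //.
  exact: subset_trans sAA (subset_trans (normal_sub nsAG) (normal_norm nsWG)).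
have : #|A| <= 2 * #|W :&: 'Z(G)|.
  apply: leq_trans cardA _; rewrite leq_mul2l subset_leq_card //.
  rewrite subsetI (subset_trans sAA sAW) -ucn1.
  apply: subset_trans (ucn_comm 1 G).
  by rewrite commSg // (subset_trans sAW).
rewrite -/z ez leqNgt; apply/negP/negPn.
by apply: leq_trans (subset_leq_card sWA); rewrite eW.
Qed.

(** Here #|W| <= p ^ 2, while #|G : 'Phi(G)| >= p ^ 2 and W :&: 'Z(G) is not
    trivial. *)
Theorem maximal_class_not_onto (p : nat) (gT : finGroupType) (G : {group gT}) :
    prime p -> p.-group G -> ~~ abelian G -> maximal_class p G ->
  ~ trace_onto G.
Proof.
move=> p_pr pG nabG maxc; apply: (layer_not_onto p_pr pG nabG).
have c_gt0 : 0 < nil_class G by rewrite ltnW // ltnNge nil_class1.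
have p_gt0 := prime_gt0 p_pr.
apply: leq_ltn_trans (_ : (p ^ 2)%N < _).
  have pc_gt0 : 0 < (p ^ (nil_class G).-1)%N by rewrite expn_gt0 p_gt0.
  rewrite -(leq_pmul2r pc_gt0) -expnD add2n prednK // maxc -card_pgroup //.
  apply: layer_card_leq => //; last by rewrite subIset ?center_sub.
    by apply: normalI; rewrite ?ZPhi_normal ?ucn_normal.
  exact: subsetIr.
apply: leq_trans (_ : (p ^ 2)%N * 2 <= _).
  by rewrite -{1}[(p ^ 2)%N]muln1 ltn_pmul2l // expn_gt0 p_gt0.
by rewrite leq_mul ?frattini_index ?(layer_centre_gt1 pG).
Qed.

(** * The three families *)

Theorem mainTheorem3 (p : nat) (p_pr : prime p) (gT : finGroupType)
    (G : {group gT}) :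
  [/\ p.-group G -> ~~ abelian G -> maximal_class p G -> S_group G,
      2.-group G -> ~~ abelian G -> coclass 2 G = 2 -> S_group G &
      p.-group G -> ~~ abelian G -> metacyclic G -> S_group G].
Proof.
split=> pG nabG famG; apply: (S_groupI pG nabG).
- exact: maximal_class_not_onto famG.
- exact: coclass2_not_onto famG.
- exact: (metacyclic_not_onto p_pr pG).
Qed.
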